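(* The range of the operator $\Delta_\Phi=\mathcal{S}_\Phi-\mathcal{I}$ on $C[t_{-\infty},t_{+\infty}]$ is the set of all $w\in C[t_{-\infty},t_{+\infty}]$ such that the infinite sums converge for all $t\in[t_{-\infty},t_{+\infty}]$, $$\left|\sum_{j=0}^\infty w(\Phi^jt)\right|<\infty,\qquad\left|\sum_{k=1}^\infty w(\Phi^{-k}t)\right|<\infty,$$ and such that $$\sum_{k=-\infty}^{+\infty}w(\Phi^kt)=Const,$$ i.e. this sum is independent of $t\in(t_{-\infty},t_{+\infty})$. In this case, either of the equations $$v(t)=v(t_{+\infty})-\sum_{j=0}^\infty w(\Phi^jt),\qquad v(t)=v(t_{-\infty})+\sum_{l=1}^\infty w(\Phi^{-l}t)$$ defines $v(t)$ such that $\Delta_\Phi v=w$, to within a constant.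
   Context: Let $t_{-\infty}<t_{+\infty}$ be real numbers and $\phi:[t_{-\infty},t_{+\infty}]\to\mathbb{R}$ with $\phi(t_{-\infty})=0=\phi(t_{+\infty})$ and $\phi(t)\ne0$ for $t\in(t_{-\infty},t_{+\infty})$. $\phi$ is assumed non-degenerate: it is Lipschitz continuous, $\phi'(t_* )\neq0$ whenever $\phi(t_* )=0$, and at any zero $t_*$ of $\phi$ one has $\phi(t)-\phi(t_* )-\phi'(t_* )(t-t_* )=O((t-t_* )^2)$ (one-sided at the endpoints). For real $\alpha$ with $0<|\alpha|<1/\|\phi\|_{Lip}$ (where $\|\phi\|_{Lip}$ is the minimal Lipschitz constant) put $\Phi(t)=t+\alpha\phi(t)$, with the standing assumption $\alpha\phi(t)>0$ on $(t_{-\infty},t_{+\infty})$; then $\Phi$ is an increasing bijection of $[t_{-\infty},t_{+\infty}]$. $\Phi^k$ is the $k$-fold composition for $k\in\mathbb{Z}$ (negative $k$ via the inverse), and $\Phi^kt\to t_{\pm\infty}$ as $k\to\pm\infty$ for $t\in(t_{-\infty},t_{+\infty})$. $\mathcal{S}_\Phi v=v\circ\Phi$, $\mathcal{I}$ is the identity, so $\Delta_\Phi v=v\circ\Phi-v$. $C[t_{-\infty},t_{+\infty}]$ is the space of continuous functions.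
   Formalization: Besides converging for all t, the two infinite sums are required to converge uniformly on compact subsets of the open interval (pointwise convergence alone is not sufficient); the first equation is imposed for t other than the left end point, the second for t other than the right one, v continuous. *)

(* Defs.v *)
From HB Require Import structures.
From mathcomp Require Import all_boot all_order all_algebra.
From mathcomp Require Import all_classical all_reals all_analysis.

Set Implicit Arguments.
Unset Strict Implicit.
Unset Printing Implicit Defensive.

Import Order.TTheory GRing.Theory Num.Theory.
Import numFieldNormedType.Exports.

Local Open Scope classical_set_scope.
Local Open Scope ring_scope.

(* Elements of C[a, b] are represented by functions R -> R of which only the
   values on [a, b] matter: continuity is for the subspace topology (one-sided
   at a and b), and every notion below evaluates its arguments on [a, b]. *)
Definition contC (R : realType) (a b : R) : set (R -> R) :=
  [set v | {within `[a, b], continuous v}].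

Definition Lip_norm (R : realType) (a b : R) (phi : R -> R) : R :=
  inf [set k : R | k.-lipschitz_(`[a, b]) phi].

(* The limit and the Landau symbol are taken within [a, b], hence are one-sided
   at the end points; d is the derivative of phi at ts. *)
Definition nondegenerate_on (R : realType) (a b : R) (phi : R -> R) : Prop :=
  [lipschitz phi x | x in `[a, b]] /\
  forall ts : R, ts \in `[a, b] -> phi ts = 0 ->
    exists d : R,
      [/\ (phi t - phi ts) / (t - ts) @[t --> within `[a, b] ts^'] --> d,
          d != 0 &
          let F := within `[a, b] (nbhs ts) in
          (fun t : R => phi t - phi ts - d * (t - ts))
            =O_F (fun t : R => (t - ts) ^+ 2)].

Definition Phi (R : realType) (alpha : R) (phi : R -> R) (t : R) : R :=
  t + alpha * phi t.

(* f^k for k in Z, with f^-1 the inverse of f as a map on [a, b]; pinv is a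
   genuine two-sided inverse when f is a bijection of [a, b]. *)
Definition iterz (R : realType) (a b : R) (f : R -> R) (k : int) : R -> R :=
  match k with
  | Posz n => iter n f
  | Negz n => iter n.+1 (pinv `[a, b] f)
  end.

Section Delta.
Context (R : realType) (a b : R) (f : R -> R).
Implicit Types (v w : R -> R) (t : R).

Definition Shift v : R -> R := v \o f.

Definition Delta v : R -> R := Shift v \- v.

Definition solves v w : Prop := {in `[a, b], Delta v =1 w}.

Definition Delta_range : set (R -> R) :=
  [set w | contC a b w /\ exists2 v, contC a b v & solves v w].

Definition fwd_psum w (n : nat) : R -> R :=
  fun t => \sum_(0 <= j < n) w (iterz a b f j%:Z t).

Definition bwd_psum w (n : nat) : R -> R :=
  fun t => \sum_(1 <= k < n) w (iterz a b f (- k%:Z) t).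

Definition fwd_sum w : R -> R :=
  fun t => limn (fwd_psum w ^~ t).

Definition bwd_sum w : R -> R :=
  fun t => limn (bwd_psum w ^~ t).

Definition bi_sum w t : R := fwd_sum w t + bwd_sum w t.

(* Pointwise convergence on [a, b] alone (even together with a constant
   two-sided sum) does not make fwd_sum w and bwd_sum w continuous on ]a, b[,
   so convergence of these series of functions also means uniform convergence
   on the compact subsets of ]a, b[. It cannot mean uniform convergence on
   [a, b]: a nonzero two-sided sum excludes that. *)
Definition sums_converge w : Prop :=
  (forall t, t \in `[a, b] ->
     cvgn (fwd_psum w ^~ t) /\ cvgn (bwd_psum w ^~ t)) /\
  (forall K : set R, compact K -> K `<=` `]a, b[ ->
     {uniform K, fwd_psum w @ \oo --> fwd_sum w} /\
     {uniform K, bwd_psum w @ \oo --> bwd_sum w}).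

Definition admissible : set (R -> R) :=
  [set w | [/\ contC a b w, sums_converge w &
               exists c : R, forall t, t \in `]a, b[ -> bi_sum w t = c]].

(* At the opposite end point (t = a, resp. t = b) the series vanishes, and the
   equation would force v a = v b: each equation is for the t whose orbit tends
   to the end point occurring in it. *)
Definition fwd_eq v w : Prop :=
  forall t, t \in `]a, b] -> v t = v b - fwd_sum w t.

Definition bwd_eq v w : Prop :=
  forall t, t \in `[a, b[ -> v t = v a + bwd_sum w t.

End Delta.

(* Main.v *)
(* Write f for Phi, g for its inverse, and let S+ and S- be the sums of w over
   the forward and the strict backward orbit.  If w = v o f - v, the partial sums
   telescope to v (f^n t) - v t and v t - v (g^n t); since f^n -> b and
   g^n -> a uniformly on compact subsets of ]a, b[, they converge there uniformly
   to S+ = v b - v and S- = v - v a.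
   Conversely, v := - S+ solves the equation and is continuous inside as a locally
   uniform limit.  For t near b, t = f^n s with n large and s in a fundamental
   domain [m, f m], and S+ (f^n s) is the n-th tail of the series at s; uniform
   convergence on [m, f m] thus gives S+ -> 0 at b.  Likewise S- -> 0 at a, and
   there v = S- - c, where c is the constant value of S+ + S-.
   The ends a and b play the same role, since S- is the sum of w o g over the
   forward orbit of g. *)
Require Import Defs.
From HB Require Import structures.
From mathcomp Require Import all_boot all_order all_algebra.
From mathcomp Require Import all_classical all_reals all_analysis.
From mathcomp Require Import lra.

Import Order.TTheory GRing.Theory Num.Theory.
Import numFieldNormedType.Exports.

Local Open Scope classical_set_scope.
Local Open Scope ring_scope.

Set Implicit Arguments.
Unset Strict Implicit.
Unset Printing Implicit Defensive.

(** * Epsilon forms of continuity and uniform convergence; compact subsets of the open interval *)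

Lemma contCP (R : realType) (a b : R) (v : R -> R) :
  contC a b v <->
  forall x, a <= x <= b -> forall e, 0 < e -> exists2 d, 0 < d &
    forall y, a <= y <= b -> `|x - y| < d -> `|v x - v y| < e.
Proof.
split=> [/subspace_continuousP cv x xab e e0|cv].
  have xab' : `[a, b]%classic x by rewrite /= in_itv.
  have /cvgrPdist_lt/(_ _ e0) := cv x xab'.
  move=> /nbhs_ballP[d /= d0 dv]; exists d => // y yab xy.
  by apply: dv => //=; rewrite in_itv.
apply/subspace_continuousP => x; rewrite /= in_itv /= => xab.
apply/cvgrPdist_lt => e e0; have [d d0 dv] := cv x xab e e0.
by apply/nbhs_ballP; exists d => // y xy; rewrite /= in_itv => yab; exact: dv.
Qed.

Lemma uniform_cvgnP (R : realType) (K : set R) (F : nat -> R -> R)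
    (G : R -> R) :
  {uniform K, F @ \oo --> G} <->
  forall e, 0 < e -> exists N, forall n t, (N <= n)%N -> K t ->
    `|G t - F n t| < e.
Proof.
split=> [FG e e0|FG].
  have [] := FG [set h | forall t, K t -> `|G t - h t| < e].
    apply/uniform_nbhs; exists [set xy | `|xy.1 - xy.2| < e]; split => //.
    exact: (entourage_ball _ (PosNum e0)).
  by move=> N _ NF; exists N => n t Nn; exact: NF.
move=> P /uniform_nbhs[E [/= entE EP]].
move: entE; rewrite -entourage_ballE => -[e /= e0 eE].
have [N NF] := FG e e0.
by exists N => // n /= Nn; apply: EP => t Kt; apply: eE; exact: NF.
Qed.

Lemma contC_comp (R : realType) (a b : R) (v h : R -> R) :
  (forall t, a <= t <= b -> a <= h t <= b) ->
  contC a b h -> contC a b v -> contC a b (v \o h).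
Proof.
move=> hI /contCP ch /contCP cv; apply/contCP => x xab e e0.
have [d d0 dv] := cv _ (hI x xab) e e0; have [d' d'0 d'h] := ch x xab d d0.
by exists d' => // y yab xy; apply: dv; [exact: hI|exact: d'h].
Qed.

Lemma contCD (R : realType) (a b : R) (v w : R -> R) :
  contC a b v -> contC a b w -> contC a b (fun t => v t + w t).
Proof. by move=> cv cw x; apply: continuousD; [exact: cv|exact: cw]. Qed.

Lemma contCN (R : realType) (a b : R) (v : R -> R) :
  contC a b v -> contC a b (fun t => - v t).
Proof. by move=> cv x; apply: continuousN; exact: cv. Qed.

Lemma contC_cst (R : realType) (a b c : R) : contC a b (fun=> c).
Proof. by apply: continuous_subspaceT => x; exact: cvg_cst. Qed.

(** The bounds are the minimum and maximum of [K], obtained as extreme values of the identity; both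
    lie in [K], hence strictly inside []a, b[]. *)
Lemma compact_itv_bounds (R : realType) (a b : R) (K : set R) :
  compact K -> K `<=` `]a, b[ -> K !=set0 ->
  exists x y, [/\ a < x, y < b & K `<=` `[x, y]].
Proof.
move=> cK Kab K0; have cid : {within K, continuous (@id R)}.
  by apply: continuous_subspaceT => x; exact: cvg_id.
have [x /set_mem Kx xmin] := compact_EVT_min K0 cK cid.
have [y /set_mem Ky ymax] := compact_EVT_max K0 cK cid.
exists x, y; split.
- by have /= := Kab _ Kx; rewrite in_itv => /andP[].
- by have /= := Kab _ Ky; rewrite in_itv => /andP[].
- by move=> t /mem_set Kt; rewrite /= in_itv /= xmin// ymax.
Qed.

(** * Orbit sums of an arbitrary self-map of the interval *)

Section Dynamics.
Context (R : realType) (a b : R).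
Implicit Types (h u v S : R -> R) (e : R).

Definition stable h := forall t, a <= t <= b -> a <= h t <= b.

Definition stable_oo h := forall t, a < t < b -> a < h t < b.

(** Locally uniform convergence on []a, b[], tested on closed segments only; [x <= y] is not
    demanded, an empty segment being harmless. *)
Definition uniform_on_segments (F : nat -> R -> R) S :=
  forall x y, a < x -> y < b -> forall eps, 0 < eps -> exists N, forall n t,
    (N <= n)%N -> x <= t <= y -> `|S t - F n t| < eps.

(** Points near the end [e] are reached from one fixed segment inside []a, b[], after as many steps
    as desired. *)
Definition late_orbits h e := exists x y, [/\ a < x, y < b &
  forall N, exists2 d, 0 < d & forall t, a < t < b -> `|e - t| < d ->
    exists n s, [/\ (N <= n)%N, x <= s <= y & t = iter n h s]].

(** Taken with [h := f], [u := w] for the forward sums and with [h := g], [u := w \o g] for the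
    backward ones. *)
Definition orbit_psum h u n t := \sum_(0 <= j < n) u (iter j h t).

Lemma iter_stable h n : stable h -> stable (iter n h).
Proof. by move=> hI; elim: n => //= n IH t tab; exact/hI/IH. Qed.

Lemma iter_stable_oo h n : stable_oo h -> stable_oo (iter n h).
Proof. by move=> hI; elim: n => //= n IH t tab; exact/hI/IH. Qed.

Lemma contC_iter h n : stable h -> contC a b h -> contC a b (iter n h).
Proof.
move=> hI ch; elim: n => [|n IH]; first by apply/contCP => x _ e e0; exists e.
by apply: (@contC_comp _ _ _ h (iter n h)) => //; exact: iter_stable.
Qed.

Lemma contC_orbit_psum h u n : stable h -> contC a b h -> contC a b u ->
  contC a b (orbit_psum h u n).
Proof.
move=> hI ch cu; elim: n => [|n IH].
  rewrite (_ : orbit_psum h u 0 = fun=> 0); first exact: contC_cst.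
  by apply/funext => t; rewrite /orbit_psum big_geq.
rewrite (_ : orbit_psum h u n.+1 =
             fun t => orbit_psum h u n t + (u \o iter n h) t).
  apply: contCD => //; apply: contC_comp => //; first exact: iter_stable.
  exact: contC_iter.
by apply/funext => t; rewrite /orbit_psum big_nat_recr.
Qed.

Lemma orbit_psum_telescope h u v n t : stable h ->
  (forall t, a <= t <= b -> v (h t) - v t = u t) -> a <= t <= b ->
  orbit_psum h u n t = v (iter n h t) - v t.
Proof.
move=> hI uE tab.
have /= <- := telescope_sumr (fun k => v (iter k h t)) (leq0n n).
apply: eq_bigr => i _.
by rewrite -uE //; exact: iter_stable.
Qed.

Lemma orbit_psumD h u m n t :
  orbit_psum h u (m + n) t = orbit_psum h u m t + orbit_psum h u n (iter m h t).
Proof.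
rewrite /orbit_psum (big_cat_nat (n := m)) //= ?leq_addr //; congr (_ + _).
rewrite -{1}[m]add0n big_addn addKn; apply: eq_bigr => i _.
by rewrite iterD.
Qed.

(** After telescoping, the error is [v e - v (iter n h t)]: continuity of [v] at the single point
    [e] makes it small, uniformly in [t]. *)
Lemma cvg_orbit_psum_telescope h u v e : a <= e <= b -> stable h ->
  uniform_on_segments (fun n => iter n h) (fun=> e) ->
  contC a b v -> (forall t, a <= t <= b -> v (h t) - v t = u t) ->
  uniform_on_segments (orbit_psum h u) (fun t => v e - v t).
Proof.
move=> eab hI hU /contCP cv uE x y ax yb eps eps0.
have [d d0 dv] := cv e eab eps eps0; have [N hN] := hU x y ax yb d d0.
exists N => n t Nn xty.
have tab : a <= t <= b by case/andP: xty => ? ?; apply/andP; split; lra.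
rewrite (orbit_psum_telescope n hI uE tab).
rewrite (_ : _ - _ - _ = v e - v (iter n h t)); last by lra.
by apply: dv; [exact: iter_stable|exact: hN].
Qed.

Lemma uniform_on_segments_cvg F S t : uniform_on_segments F S ->
  a < t < b -> F ^~ t @ \oo --> S t.
Proof.
move=> FS /andP[at_ tb]; apply/cvgrPdist_lt => e e0.
have [N hN] := FS t t at_ tb e e0.
by exists N => // n /= Nn; apply: hN; rewrite // lexx.
Qed.

(** The partial sums of length [m + n] at [t] have limit [S t]; cut after [n] terms, they also tend
    to the first [n] terms plus the sum started at [iter n h t]. *)
Lemma orbit_sum_tail h u S n t : stable_oo h ->
  uniform_on_segments (orbit_psum h u) S -> a < t < b ->
  S (iter n h t) = S t - orbit_psum h u n t.
Proof.
move=> hI uS tab.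
have ntab : a < iter n h t < b by exact: iter_stable_oo.
have cvg_t : [sequence orbit_psum h u (m + n)%N t]_m @ \oo --> S t.
  rewrite (cvg_shiftn n (orbit_psum h u ^~ t)).
  exact: uniform_on_segments_cvg.
have cvg_nt : [sequence orbit_psum h u (m + n)%N t]_m @ \oo -->
    orbit_psum h u n t + S (iter n h t).
  rewrite (_ : [sequence _]_m =
    fun m => orbit_psum h u n t + orbit_psum h u m (iter n h t)).
    by apply: cvgD; [exact: cvg_cst|exact: uniform_on_segments_cvg].
  by apply/funext => m /=; rewrite addnC orbit_psumD.
have -> := cvg_unique _ cvg_t cvg_nt; last exact: Rhausdorff.
by rewrite addrC addKr.
Qed.

Lemma orbit_sum_cvg0 h u S e : stable_oo h -> late_orbits h e ->
  uniform_on_segments (orbit_psum h u) S -> forall eps, 0 < eps ->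
  exists2 d, 0 < d & forall t, a < t < b -> `|e - t| < d -> `|S t| < eps.
Proof.
move=> hI [x [y [ax yb hL]]] uS eps eps0.
have [N hN] := uS x y ax yb eps eps0; have [d d0 hd] := hL N; exists d => //.
move=> t tab /(hd t tab)[n [s [Nn xsy ->]]].
rewrite (orbit_sum_tail _ _ uS) //; first exact: hN.
by case/andP: xsy => ? ?; apply/andP; split; lra.
Qed.

(** The usual three-epsilon argument: a partial sum is continuous and uniformly close to [S] on a
    segment around [x]. *)
Lemma orbit_sum_continuous h u S : stable h -> contC a b h -> contC a b u ->
  uniform_on_segments (orbit_psum h u) S -> forall x, a < x < b ->
  forall eps, 0 < eps ->
  exists2 d, 0 < d & forall y, a <= y <= b -> `|x - y| < d ->
    `|S x - S y| < eps.
Proof.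
move=> hI ch cu uS x /andP[ax xb] eps eps0.
have eps3 : 0 < eps / 3 by lra.
have [|| N hN] := uS ((a + x) / 2) ((x + b) / 2) _ _ _ eps3; [lra..|].
have /contCP cN := contC_orbit_psum (n := N) hI ch cu.
have xab : a <= x <= b by apply/andP; split; lra.
have [d d0 hd] := cN x xab _ eps3.
(* The last two bounds keep [y] in the segment [[(a + x) / 2, (x + b) / 2]] of uniform
   convergence. *)
exists (Num.min d (Num.min ((x - a) / 2) ((b - x) / 2))).
  by rewrite !lt_min; apply/and3P; split => //; lra.
move=> y yab; rewrite !lt_min => /and3P[xyd xya xyb].
have := hd y yab xyd.
have := hN N x (leqnn N); have := hN N y (leqnn N).
move: xya xyb; rewrite !ltr_norml => /andP[? ?] /andP[? ?].
have -> : (a + x) / 2 <= x <= (x + b) / 2 by apply/andP; split; lra.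
have -> : (a + x) / 2 <= y <= (x + b) / 2 by apply/andP; split; lra.
move=> /(_ isT)/andP[? ?] /(_ isT)/andP[? ?] /andP[? ?].
by apply/andP; split; lra.
Qed.

End Dynamics.

(** * Increasing bijections that push interior points to the right *)

(** Gathers the properties of [Phi] and its inverse on which the dynamics rests, so that the formula
    for [Phi] enters only when the record is built. *)
Record displacement (R : realType) (a b : R) (f g : R -> R) : Prop := {
  disp_lt : a < b;
  disp_stable : stable a b f;
  disp_stableV : stable a b g;
  dispK : forall t, a <= t <= b -> g (f t) = t;
  dispKV : forall t, a <= t <= b -> f (g t) = t;
  disp_le : forall x y, a <= x <= b -> a <= y <= b -> (f x <= f y) = (x <= y);
  disp_left : f a = a;
  disp_right : f b = b;
  disp_gt : forall t, a < t < b -> t < f t;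
  disp_cont : contC a b f
}.

Section Displacement.
Context (R : realType) (a b : R) (f g : R -> R) (fg : displacement a b f g).

Let ab := disp_lt fg.
Let fI := disp_stable fg.
Let gI := disp_stableV fg.
Let fK := dispK fg.
Let gK := dispKV fg.
Let f_le := disp_le fg.
Let fa := disp_left fg.
Let fb := disp_right fg.
Let f_gt := disp_gt fg.

Let aab : a <= a <= b. Proof. by rewrite lexx ltW. Qed.
Let bab : a <= b <= b. Proof. by rewrite lexx ltW. Qed.

Let oo_cc t : a < t < b -> a <= t <= b.
Proof. by move=> /andP[? ?]; apply/andP; split; exact: ltW. Qed.

Lemma g_le x y : a <= x <= b -> a <= y <= b -> (g x <= g y) = (x <= y).
Proof. by move=> xab yab; rewrite -f_le ?gK //; exact: gI. Qed.

Let f_lt x y : a <= x <= b -> a <= y <= b -> (f x < f y) = (x < y).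
Proof. by move=> xab yab; rewrite !ltNge f_le. Qed.

Let g_lt x y : a <= x <= b -> a <= y <= b -> (g x < g y) = (x < y).
Proof. by move=> xab yab; rewrite !ltNge g_le. Qed.

Lemma disp_leftV : g a = a. Proof. by rewrite -{1}fa fK. Qed.

Lemma disp_rightV : g b = b. Proof. by rewrite -{1}fb fK. Qed.

Lemma f_stable_oo : stable_oo a b f.
Proof.
move=> t tab; have tcc := oo_cc tab.
by rewrite -{1}fa -{1}fb !f_lt.
Qed.

Lemma g_stable_oo : stable_oo a b g.
Proof.
move=> t tab; have tcc := oo_cc tab.
by rewrite -{1}disp_leftV -{1}disp_rightV !g_lt.
Qed.

Lemma iter_f_le n x y : a <= x <= b -> a <= y <= b ->
  (iter n f x <= iter n f y) = (x <= y).
Proof.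
move=> xab yab; elim: n => //= n <-; rewrite f_le //; exact: iter_stable.
Qed.

Lemma iter_g_le n x y : a <= x <= b -> a <= y <= b ->
  (iter n g x <= iter n g y) = (x <= y).
Proof.
move=> xab yab; elim: n => //= n <-; rewrite g_le //; exact: iter_stable.
Qed.

Lemma iter_fgK n t : a <= t <= b -> iter n f (iter n g t) = t.
Proof.
move=> tab; elim: n => // n IH; rewrite iterSr /= gK //; exact: iter_stable.
Qed.

Lemma iter_gfK n t : a <= t <= b -> iter n g (iter n f t) = t.
Proof.
move=> tab; elim: n => // n IH; rewrite iterSr /= fK //; exact: iter_stable.
Qed.

Lemma f_ge t : a <= t <= b -> t <= f t.
Proof.
move=> /andP[]; rewrite le_eqVlt => /predU1P[<- _|at_]; first by rewrite fa.
rewrite le_eqVlt => /predU1P[->|tb]; first by rewrite fb.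
by apply/ltW/f_gt; rewrite at_.
Qed.

Lemma g_le_id t : a <= t <= b -> g t <= t.
Proof. by move=> tab; rewrite -{2}(gK tab); apply/f_ge/gI. Qed.

Lemma iter_f_homo x m n : a <= x <= b -> (m <= n)%N -> iter m f x <= iter n f x.
Proof.
move=> xab /subnK <-; elim: (n - m)%N => // k IH.
by rewrite addSn /= (le_trans IH) // f_ge //; exact: iter_stable.
Qed.

Lemma iter_g_homo x m n : a <= x <= b -> (m <= n)%N -> iter n g x <= iter m g x.
Proof.
move=> xab /subnK <-; elim: (n - m)%N => // k IH.
by rewrite addSn /= (le_trans _ IH) // g_le_id //; exact: iter_stable.
Qed.

(* The supremum [l] of the orbit cannot lie below [b]: the orbit meets
   ]g l, l], hence its next point is larger than [l]. *)
Lemma iter_f_gt x c : a < x <= b -> c < b -> exists n, c < iter n f x.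
Proof.
move=> /andP[ax xb] cb; have xab : a <= x <= b by rewrite ltW.
apply: contrapT => /forallNP nc; pose E := range (fun n => iter n f x).
have E0 : E !=set0 by exists x, 0%N.
have cE : ubound E c by move=> _ [n _ <-]; rewrite leNgt; exact/negP.
have hE : has_sup E by split => //; exists c.
have xl : x <= sup E by apply: sup_upper_bound => //; exists 0%N.
have lc : sup E <= c by exact: ge_sup.
have lab : a < sup E < b by apply/andP; split; lra.
have gl : 0 < sup E - g (sup E).
  by rewrite subr_gt0 -{2}(gK (oo_cc lab)); apply/f_gt/g_stable_oo.
have [_ [n _ <-]] := sup_adherent gl hE.
rewrite subKr -f_lt ?gK; last first.
- exact: iter_stable.
- exact/gI/oo_cc.
- exact: oo_cc.
by apply/negP; rewrite -leNgt; apply: sup_upper_bound => //; exists n.+1.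
Qed.

(** Mirror argument: with [l] the infimum of the orbit, the orbit meets [[l, f l[], and its next
    point lies below [l]. *)
Lemma iter_g_lt y c : a <= y < b -> a < c -> exists n, iter n g y < c.
Proof.
move=> /andP[ay yb] ac; have yab : a <= y <= b by rewrite ay ltW.
apply: contrapT => /forallNP nc; pose E := range (fun n => iter n g y).
have E0 : E !=set0 by exists y, 0%N.
have cE : lbound E c by move=> _ [n _ <-]; rewrite leNgt; exact/negP.
have hE : has_inf E by split => //; exists c.
have ly : inf E <= y by apply: ge_inf; [exists c|exists 0%N].
have cl : c <= inf E by exact: lb_le_inf.
have lab : a < inf E < b by apply/andP; split; lra.
have fl : 0 < f (inf E) - inf E by rewrite subr_gt0 f_gt.
have [_ [n _ <-]] := inf_adherent fl hE.
rewrite addrC subrK -g_lt ?fK; last first.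
- exact/fI/oo_cc.
- exact: iter_stable.
- exact: oo_cc.
by apply/negP; rewrite -leNgt; apply: ge_inf; [exists c|exists n.+1].
Qed.

(** Iterates preserve order, so the left end [x] is the slowest point of the segment: once its orbit
    passes [b - eps], the whole segment has. *)
Lemma iter_f_cvg : uniform_on_segments a b (fun n => iter n f) (fun=> b).
Proof.
(* If [b < x], then [y < x] and the segment is empty. *)
move=> x y ax yb eps eps0; have [xb|bx] := lerP x b; last first.
  by exists 0%N => n t _ /andP[? ?]; lra.
have xab : a <= x <= b by rewrite ltW.
have [||N hN] := @iter_f_gt x (b - eps); [by rewrite ax|lra|].
exists N => n t Nn /andP[xt ty].
have tab : a <= t <= b by apply/andP; split; lra.
have /andP[? ?] := iter_stable n fI tab.
have := iter_f_homo xab Nn; have := iter_f_le n xab tab; rewrite xt => ? ?.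
by rewrite ger0_norm; lra.
Qed.

(** Here the right end [y] is the slowest point. *)
Lemma iter_g_cvg : uniform_on_segments a b (fun n => iter n g) (fun=> a).
Proof.
move=> x y ax yb eps eps0; have [ay|ya] := lerP a y; last first.
  by exists 0%N => n t _ /andP[? ?]; lra.
have yab : a <= y <= b by rewrite ay ltW.
have [||N hN] := @iter_g_lt y (a + eps); [by rewrite ay|lra|].
exists N => n t Nn /andP[xt ty].
have tab : a <= t <= b by apply/andP; split; lra.
have /andP[? ?] := iter_stable n gI tab.
have := iter_g_homo yab Nn; have := iter_g_le n tab yab; rewrite ty => ? ?.
by rewrite distrC ger0_norm; lra.
Qed.

Let mid := (a + b) / 2.

Let mid_oo : a < mid < b. Proof. by rewrite !midf_lt. Qed.

(* [mid, f mid] is a fundamental domain: every orbit in ]a, b[ meets it. *)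
Lemma late_orbits_f : late_orbits a b f b.
Proof.
have m_cc := oo_cc mid_oo; have fm_oo := f_stable_oo mid_oo.
have fm_cc := oo_cc fm_oo; have /andP[am mb] := mid_oo.
exists mid, (f mid); split => //; first by case/andP: fm_oo.
move=> N; have /andP[aN Nb] := iter_stable_oo N f_stable_oo fm_oo.
exists (b - iter N f (f mid)); first by rewrite subr_gt0.
move=> t tab; have tcc := oo_cc tab; have /andP[at_ tb] := tab.
rewrite gtr0_norm ?subr_gt0 // ltrD2l ltrN2 => Nt.
have hits : exists n, iter n g t <= f mid.
  have [||n nt] := @iter_g_lt t (f mid); [by rewrite ltW|by case/andP: fm_oo|].
  by exists n; exact: ltW.
(* The preimage sought is the first backward iterate that is at most [f mid]. *)
case: (ex_minnP hits) => n hn nmin.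
have Nn : (N < n)%N.
  rewrite ltnNge; apply/negP => nN; move: Nt; apply/negP; rewrite -leNgt.
  rewrite -(iter_fgK n tcc) (le_trans _ (iter_f_homo fm_cc nN)) //.
  by rewrite iter_f_le //; exact: iter_stable.
exists n, (iter n g t); split; [exact: ltnW| |by rewrite iter_fgK].
rewrite hn andbT; case: n => // n in hn nmin Nn *.
have n_cc := iter_stable n gI tcc.
(* Were this iterate below [mid], the one before it would already be at most [f mid], against
   minimality; [N < n] ensures that there is one before. *)
rewrite /= -(fK m_cc) g_le // ltW // ltNge; apply/negP => /nmin.
by rewrite ltnn.
Qed.

(** Same fundamental domain, with [f] applied to [t] until the orbit first reaches [mid]; by
    minimality it lands no further than [f mid]. *)
Lemma late_orbits_g : late_orbits a b g a.
Proof.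
have m_cc := oo_cc mid_oo; have fm_oo := f_stable_oo mid_oo.
have fm_cc := oo_cc fm_oo; have /andP[am mb] := mid_oo.
exists mid, (f mid); split => //; first by case/andP: fm_oo.
move=> N; have /andP[aN Nb] := iter_stable_oo N g_stable_oo mid_oo.
exists (iter N g mid - a); first by rewrite subr_gt0.
move=> t tab; have tcc := oo_cc tab; have /andP[at_ tb] := tab.
rewrite distrC gtr0_norm ?subr_gt0 // ltrD2r => Nt.
have hits : exists n, mid <= iter n f t.
  have [||n nt] := @iter_f_gt t mid; [by rewrite at_ ltW|by []|].
  by exists n; exact: ltW.
case: (ex_minnP hits) => n hn nmin.
have Nn : (N < n)%N.
  rewrite ltnNge; apply/negP => nN; move: Nt; apply/negP; rewrite -leNgt.
  rewrite -(iter_gfK n tcc) (le_trans (iter_g_homo m_cc nN)) //.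
  by rewrite iter_g_le //; exact: iter_stable.
exists n, (iter n f t); split; [exact: ltnW| |by rewrite iter_gfK].
rewrite hn /=; case: n => // n in hn nmin Nn *.
have n_cc := iter_stable n fI tcc.
rewrite /= f_le // ltW // ltNge; apply/negP => /nmin.
by rewrite ltnn.
Qed.

End Displacement.

(** * The sums over forward and backward orbits *)

Section Range.
Context (R : realType) (a b : R) (f : R -> R).
Let g := pinv `[a, b] f.
Context (fg : displacement a b f g).
Implicit Types (v w S : R -> R) (t c : R).

Let ab := disp_lt fg.
Let fI := disp_stable fg.
Let gI := disp_stableV fg.
Let gK := dispKV fg.
Let fa := disp_left fg.
Let fb := disp_right fg.
Let f_oo := f_stable_oo fg.
Let g_oo := g_stable_oo fg.
Let cf := disp_cont fg.

Let aab : a <= a <= b. Proof. by rewrite lexx ltW. Qed.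
Let bab : a <= b <= b. Proof. by rewrite lexx ltW. Qed.

Let oo_or_end t : a <= t <= b -> [\/ t = a, t = b | a < t < b].
Proof.
move=> /andP[]; rewrite le_eqVlt => /predU1P[<- _|at_]; first exact: Or31.
rewrite le_eqVlt => /predU1P[->|tb]; first exact: Or32.
by apply: Or33; rewrite at_.
Qed.

(** Segments are compact, and a nonempty compact subset of []a, b[] lies in a segment of []a,
    b[]. *)
Lemma uniform_on_segmentsP (F : nat -> R -> R) S :
  (forall K, compact K -> K `<=` `]a, b[ -> {uniform K, F @ \oo --> S}) <->
  uniform_on_segments a b F S.
Proof.
split=> [FS x y ax yb eps eps0|FS K cK Kab].
  have xyab : `[x, y] `<=` `]a, b[.
    by move=> t /=; rewrite !in_itv /= => /andP[? ?]; apply/andP; split; lra.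
  have /uniform_cvgnP/(_ eps eps0)[N hN] := FS _ (@segment_compact _ x y) xyab.
  by exists N => n t Nn xty; apply: hN; rewrite //= in_itv.
apply/uniform_cvgnP => e e0; have [->|/set0P K0] := eqVneq K set0.
  by exists 0%N.
have [x [y [ax yb Kxy]]] := compact_itv_bounds cK Kab K0.
have [N hN] := FS x y ax yb e e0; exists N => n t Nn /Kxy.
by rewrite /= in_itv /=; exact: hN.
Qed.

Lemma eq_uniform_on_segments (F : nat -> R -> R) S S' :
  (forall t, a < t < b -> S t = S' t) ->
  uniform_on_segments a b F S -> uniform_on_segments a b F S'.
Proof.
move=> SS' FS x y ax yb eps eps0; have [N hN] := FS x y ax yb eps eps0.
exists N => n t Nn xty; rewrite -SS'; first exact: hN.
by case/andP: xty => ? ?; apply/andP; split; lra.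
Qed.

(** The backward sum starts at index 1, so the bound [n.+1] gives [n] terms; the extra application
    of [g] is absorbed into [w \o g]. *)
Lemma bwd_psumS w n t : bwd_psum a b f w n.+1 t = orbit_psum g (w \o g) n t.
Proof. by rewrite /bwd_psum big_add1. Qed.

Lemma cvg_bwd_psum w t (l : R) :
  (bwd_psum a b f w ^~ t @ \oo --> l) =
  (orbit_psum g (w \o g) ^~ t @ \oo --> l).
Proof.
rewrite -cvg_shiftS (_ : [sequence _]_n = orbit_psum g (w \o g) ^~ t) //.
by apply/funext => n /=; rewrite bwd_psumS.
Qed.

Lemma uniform_on_segments_bwd w S :
  uniform_on_segments a b (bwd_psum a b f w) S <->
  uniform_on_segments a b (orbit_psum g (w \o g)) S.
Proof.
split=> FS x y ax yb eps eps0; have [N hN] := FS x y ax yb eps eps0.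
  by exists N => n t Nn xty; rewrite -bwd_psumS; apply: hN => //; exact: leqW.
by exists N.+1 => -[//|n] t Nn xty; rewrite bwd_psumS; exact: hN.
Qed.

(** Serves at the two end points, where all terms of the series vanish. *)
Lemma cvg_orbit_psum_fixpoint h w t : h t = t -> w t = 0 ->
  orbit_psum h w ^~ t @ \oo --> (0 : R).
Proof.
move=> ht wt; rewrite (_ : orbit_psum h w ^~ t = fun=> 0); first exact: cvg_cst.
apply/funext => n; rewrite /orbit_psum big1 // => i _.
by rewrite iter_fix.
Qed.

(** * A continuous solution makes the sums converge *)

Section Solution.
Context (v w : R -> R) (cv : contC a b v) (vw : solves a b f v w).

Let vwE t : a <= t <= b -> v (f t) - v t = w t.
Proof. by move=> tab; apply: vw; rewrite in_itv. Qed.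

Let wa : w a = 0. Proof. by rewrite -vwE // fa subrr. Qed.
Let wb : w b = 0. Proof. by rewrite -vwE // fb subrr. Qed.

Let fwd_uniform :
  uniform_on_segments a b (fwd_psum a b f w) (fun t => v b - v t).
Proof.
apply: cvg_orbit_psum_telescope => //.
exact: iter_f_cvg fg.
Qed.

Let bwd_uniform :
  uniform_on_segments a b (bwd_psum a b f w) (fun t => v t - v a).
Proof.
apply/uniform_on_segments_bwd.
(* Along [g] it is [- v] that telescopes: [- v (g t) + v t = w (g t)]. *)
apply: (@eq_uniform_on_segments _ (fun t => - v a - - v t)).
  by move=> t _; rewrite opprK addrC.
apply: (@cvg_orbit_psum_telescope _ _ _ g _ (fun t => - v t)) => //.
- exact: iter_g_cvg fg.
- exact: contCN.
- by move=> t tab /=; rewrite -vwE ?gK; [lra|by []|exact: gI].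
Qed.

Lemma solves_fwd_cvg t : a < t <= b ->
  fwd_psum a b f w ^~ t @ \oo --> v b - v t.
Proof.
move=> /andP[at_]; rewrite le_eqVlt => /predU1P[->|tb].
  by rewrite subrr; exact: cvg_orbit_psum_fixpoint.
by apply: uniform_on_segments_cvg fwd_uniform _; rewrite at_.
Qed.

Lemma solves_bwd_cvg t : a <= t < b ->
  bwd_psum a b f w ^~ t @ \oo --> v t - v a.
Proof.
move=> /andP[]; rewrite le_eqVlt => /predU1P[<- _|at_ tb].
  rewrite subrr cvg_bwd_psum.
  by apply: cvg_orbit_psum_fixpoint; rewrite /= ?(disp_leftV fg).
by apply: uniform_on_segments_cvg bwd_uniform _; rewrite at_.
Qed.

Lemma solves_fwd_sum t : a < t <= b -> fwd_sum a b f w t = v b - v t.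
Proof. by move=> /solves_fwd_cvg /cvg_lim; apply; exact: Rhausdorff. Qed.

Lemma solves_bwd_sum t : a <= t < b -> bwd_sum a b f w t = v t - v a.
Proof. by move=> /solves_bwd_cvg /cvg_lim; apply; exact: Rhausdorff. Qed.

Lemma solves_sums_converge : sums_converge a b f w.
Proof.
split=> [t|K cK Kab].
  rewrite in_itv /= => /andP[at_ tb]; split.
    (* The fixed point [a] never moves to [b]; there the series is zero because [w a = 0]. *)
    move: at_; rewrite le_eqVlt => /predU1P[<-|at_].
      by apply: cvgP; exact: cvg_orbit_psum_fixpoint.
    by apply: cvgP; apply: solves_fwd_cvg; rewrite at_.
  move: tb; rewrite le_eqVlt => /predU1P[->|tb].
    apply: (@cvgP _ _ 0); rewrite cvg_bwd_psum.
    by apply: cvg_orbit_psum_fixpoint; rewrite /= ?(disp_rightV fg).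
  by apply: cvgP; apply: solves_bwd_cvg; rewrite at_.
split; move: K cK Kab; apply/uniform_on_segmentsP.
  apply: eq_uniform_on_segments fwd_uniform => t /andP[at_ tb].
  by rewrite solves_fwd_sum // at_ ltW.
apply: eq_uniform_on_segments bwd_uniform => t /andP[at_ tb].
by rewrite solves_bwd_sum // tb ltW.
Qed.

Lemma solves_bi_sum t : a < t < b -> bi_sum a b f w t = v b - v a.
Proof.
move=> /andP[at_ tb]; rewrite /bi_sum solves_fwd_sum ?at_ ?ltW //.
by rewrite solves_bwd_sum ?tb ?ltW //; lra.
Qed.

End Solution.

(** * Construction of a continuous solution from the sums *)

Section Admissible.
Context (w : R -> R) (w_adm : admissible a b f w).

(** At a fixed point the forward series has constant term [w t], and it converges only if that term
    is 0. *)
Lemma admissible_fixpoint t : a <= t <= b -> f t = t -> w t = 0.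
Proof.
have [_ [cvgw _] _] := w_adm; move=> tab ft.
have [|+ _] := cvgw t; first by rewrite in_itv.
rewrite (_ : fwd_psum a b f w ^~ t = series (fun=> w t)).
  move=> /cvg_series_cvg_0 /(cvg_unique _ (cvg_cst _)); apply.
  exact: Rhausdorff.
apply/funext => n; apply: eq_bigr => i _.
by rewrite /= iter_fix.
Qed.

Lemma admissible_solvable : exists2 v, contC a b v & solves a b f v w.
Proof.
have [cw [_ uw] [c hc]] := w_adm.
have wa : w a = 0 by exact: admissible_fixpoint.
have wb : w b = 0 by exact: admissible_fixpoint.
have uf : uniform_on_segments a b (orbit_psum f w) (fwd_sum a b f w).
  by apply/uniform_on_segmentsP => K cK /(uw K cK)[].
have ug : uniform_on_segments a b (orbit_psum g (w \o g)) (bwd_sum a b f w).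
  by apply/uniform_on_segments_bwd/uniform_on_segmentsP => K cK /(uw K cK)[].
have Sb : fwd_sum a b f w b = 0.
  by apply/cvg_lim; [exact: Rhausdorff|exact: cvg_orbit_psum_fixpoint].
(* At [a] the forward series is 0, whereas [- fwd_sum] tends to [- c] there; the value at [a] is
   therefore prescribed. *)
pose v t := if t == a then - c else - fwd_sum a b f w t.
have va : v a = - c by rewrite /v eqxx.
have vE t : a < t -> v t = - fwd_sum a b f w t by rewrite /v => /gt_eqF ->.
exists v; last first.
  move=> t; rewrite in_itv /= => /oo_or_end[->|->|tab].
  - by rewrite /Delta /Shift /= fa subrr wa.
  - by rewrite /Delta /Shift /= fb subrr wb.
  have /andP[at_ _] := tab; have /andP[aft _] := f_oo tab.
  rewrite /Delta /Shift /= !vE // opprK.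
  (* Dropping one term: [S (f t) = S t - w t] for the forward sum [S]. *)
  have := orbit_sum_tail 1 f_oo uf tab; rewrite /orbit_psum big_nat1 /= => ->.
  by lra.
apply/contCP => x /oo_or_end[->|->|xab] e e0.
- have L := late_orbits_g fg.
  have [d d0 hd] := orbit_sum_cvg0 g_oo L ug e0.
  (* The bound [b - a] excludes [y = b]. For interior [y], [v a - v y = - c + S+ y = - S- y], which
     is small near [a]. *)
  exists (Num.min d (b - a)) => [|y /oo_or_end[->|->|yab]].
  + by rewrite lt_min d0 subr_gt0.
  + by rewrite !subrr normr0.
  + by rewrite lt_min distrC gtr0_norm ?subr_gt0 // ltxx andbF.
  rewrite lt_min => /andP[/(hd y yab) + _]; have /andP[ay _] := yab.
  have := hc y; rewrite in_itv /= => /(_ yab); rewrite va vE // /bi_sum => <-.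
  by rewrite opprK opprD addrAC addNr add0r normrN.
- have L := late_orbits_f fg.
  have [d d0 hd] := orbit_sum_cvg0 f_oo L uf e0.
  exists (Num.min d (b - a)) => [|y /oo_or_end[->|->|yab]].
  + by rewrite lt_min d0 subr_gt0.
  + by rewrite lt_min gtr0_norm ?subr_gt0 // ltxx andbF.
  + by rewrite !subrr normr0.
  rewrite lt_min => /andP[/(hd y yab) + _]; have /andP[ay _] := yab.
  by rewrite !vE // Sb oppr0 sub0r opprK.
have /andP[ax xb] := xab.
have [d d0 hd] := orbit_sum_continuous fI cf cw uf xab e0.
(* The bound [x - a] keeps [y] away from [a], so that [v y] is given by the forward sum. *)
exists (Num.min d (x - a)) => [|y yab]; first by rewrite lt_min d0 subr_gt0.
rewrite lt_min => /andP[xyd xya]; have := hd y yab xyd.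
have ay : a < y by move: xya; rewrite ltr_norml => /andP[? ?]; lra.
by rewrite !vE // -opprD normrN.
Qed.

End Admissible.

(** * The range, the two solution formulas, and uniqueness up to a constant *)

Lemma solves_admissible v w : contC a b w -> contC a b v -> solves a b f v w ->
  admissible a b f w.
Proof.
move=> cw cv vw; split => //; first exact: (solves_sums_converge cv vw).
by exists (v b - v a) => t; rewrite in_itv /= => tab; exact: solves_bi_sum.
Qed.

Lemma Delta_rangeE : Delta_range a b f = admissible a b f.
Proof.
apply/seteqP; split=> [w [cw [v cv vw]]|w aw].
  exact: solves_admissible vw.
by split; [case: aw|exact: admissible_solvable].
Qed.

(** For the converse, [v] is compared with a known solution [u]: on []a, b]] they differ by the
    constant [v b - u b]. At the fixed ends the equation reads [0 = 0]. *)
Lemma solves_fwdP v w : admissible a b f w -> contC a b v ->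
  solves a b f v w <-> fwd_eq a b f v w.
Proof.
move=> aw cv; split=> [vw t|veq].
  rewrite in_itv /= => tab; rewrite (solves_fwd_sum cv vw) //.
  by rewrite subKr.
have [u cu uw] := admissible_solvable aw.
have vE t : a < t <= b -> v t = v b - u b + u t.
  move=> tab; rewrite veq ?in_itv // (solves_fwd_sum cu uw) //.
  by rewrite opprB addrA addrAC.
move=> t; rewrite in_itv /= => /oo_or_end[->|->|tab].
- by rewrite /Delta /Shift /= fa subrr (admissible_fixpoint aw).
- by rewrite /Delta /Shift /= fb subrr (admissible_fixpoint aw).
have /andP[at_ tb] := tab; have /andP[aft ftb] := f_oo tab.
rewrite -uw ?in_itv /= ?ltW //= /Delta /Shift /=.
rewrite (vE t) ?at_ ?ltW // (vE (f t)) ?aft ?ltW //; lra.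
Qed.

(** As for the forward equation, with the constant [v a - u a] on [[a, b[]. *)
Lemma solves_bwdP v w : admissible a b f w -> contC a b v ->
  solves a b f v w <-> bwd_eq a b f v w.
Proof.
move=> aw cv; split=> [vw t|veq].
  rewrite in_itv /= => tab; rewrite (solves_bwd_sum cv vw) //.
  by rewrite addrC subrK.
have [u cu uw] := admissible_solvable aw.
have vE t : a <= t < b -> v t = v a - u a + u t.
  move=> tab; rewrite veq ?in_itv // (solves_bwd_sum cu uw) //.
  by rewrite addrA addrAC.
move=> t; rewrite in_itv /= => /oo_or_end[->|->|tab].
- by rewrite /Delta /Shift /= fa subrr (admissible_fixpoint aw).
- by rewrite /Delta /Shift /= fb subrr (admissible_fixpoint aw).
have /andP[at_ tb] := tab; have /andP[aft ftb] := f_oo tab.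
rewrite -uw ?in_itv /= ?ltW //= /Delta /Shift /=.
rewrite (vE t) ?tb ?ltW // (vE (f t)) ?ftb ?ltW //; lra.
Qed.

Lemma solves_addC v w c : solves a b f v w ->
  solves a b f (fun t => v t + c) w.
Proof.
by move=> vw t tab; rewrite -vw // /Delta /Shift /= opprD addrACA subrr addr0.
Qed.

Lemma fwd_eq_ex w c : admissible a b f w ->
  exists v, [/\ contC a b v, v b = c & fwd_eq a b f v w].
Proof.
move=> aw; have [u cu uw] := admissible_solvable aw.
have cuc : contC a b (fun t => u t + (c - u b)).
  by apply: contCD => //; exact: contC_cst.
exists (fun t => u t + (c - u b)); split => //; first by rewrite addrC subrK.
by apply/solves_fwdP => //; exact: solves_addC.
Qed.

Lemma bwd_eq_ex w c : admissible a b f w ->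
  exists v, [/\ contC a b v, v a = c & bwd_eq a b f v w].
Proof.
move=> aw; have [u cu uw] := admissible_solvable aw.
have cuc : contC a b (fun t => u t + (c - u a)).
  by apply: contCD => //; exact: contC_cst.
exists (fun t => u t + (c - u a)); split => //; first by rewrite addrC subrK.
by apply/solves_bwdP => //; exact: solves_addC.
Qed.

Lemma solves_unique v v' w : contC a b v -> contC a b v' -> solves a b f v w ->
  (solves a b f v' w <->
   exists c, forall t, t \in `[a, b] -> v' t = v t + c).
Proof.
move=> cv cv' vw; split=> [v'w|[c v'E] t tab]; last first.
  have ftab : f t \in `[a, b] by move: tab; rewrite !in_itv; exact: fI.
  by rewrite -vw // /Delta /Shift /= !v'E //; lra.
exists (v' b - v b) => t; rewrite in_itv /= => /andP[at_ tb].
have fwd s : a < s <= b -> v' s = v s + (v' b - v b).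
  move=> sab; have := solves_fwd_sum cv vw sab.
  by rewrite (solves_fwd_sum cv' v'w sab); lra.
(* The forward sums do not reach [a]; the backward sums at the midpoint carry the same constant
   there. *)
have [mid1 mid2] : a < (a + b) / 2 /\ (a + b) / 2 < b by rewrite !midf_lt.
move: at_; rewrite le_eqVlt => /predU1P[<-|at_]; last first.
  by apply: fwd; rewrite at_.
have mE : v' ((a + b) / 2) = v ((a + b) / 2) + (v' b - v b).
  by apply: fwd; rewrite mid1 ltW.
have mab : a <= (a + b) / 2 < b by rewrite mid2 ltW.
have := solves_bwd_sum cv vw mab; rewrite (solves_bwd_sum cv' v'w mab).
by lra.
Qed.

End Range.

(** * The map [Phi] is a displacement *)

(** Since the infimum of the Lipschitz constants is below [c^-1], some Lipschitz constant [k] is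
    too. *)
Lemma Lip_norm_lipschitz (R : realType) (a b : R) (phi : R -> R) (c : R) :
  0 < c -> c < 1 / Lip_norm a b phi ->
  exists2 k, c * k < 1 & forall x y, a <= x <= b -> a <= y <= b ->
    `|phi x - phi y| <= k * `|x - y|.
Proof.
move=> c0 cL; have L0 : 0 < Lip_norm a b phi.
  by rewrite -invr_gt0 -div1r (lt_trans c0).
(* [inf] takes the default value 0 on a set without infimum, which positivity rules out. *)
have hE : has_inf [set k : R | k.-lipschitz_(`[a, b]) phi].
  by apply: contrapT => /inf_out L_eq0; rewrite /Lip_norm L_eq0 ltxx in L0.
have [|k phik kL] := inf_adherent (_ : 0 < c^-1 - Lip_norm a b phi) hE.
  by rewrite subr_gt0 -ltf_pV2 ?posrE ?invr_gt0 // invrK -div1r.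
exists k.
  by rewrite addrC subrK in kL; rewrite mulrC -ltr_pdivlMr // div1r.
move=> x y xab yab; apply: (phik (x, y)).
by split; rewrite /= in_itv.
Qed.

(** As [alpha * phi] has Lipschitz constant [q < 1], the identity dominates and [Phi] is strictly
    increasing; the intermediate value theorem gives surjectivity, so [pinv] is a two-sided
    inverse. *)
Lemma displacement_Phi (R : realType) (a b : R) (phi : R -> R) (alpha : R) :
  a < b -> phi a = 0 -> phi b = 0 ->
  (forall t, t \in `]a, b[ -> 0 < alpha * phi t) ->
  0 < `|alpha| -> `|alpha| < 1 / Lip_norm a b phi ->
  displacement a b (Phi alpha phi) (pinv `[a, b] (Phi alpha phi)).
Proof.
move=> ab phia phib phi_gt0 alpha0 alpha_lt.
have [k k1 phik] := Lip_norm_lipschitz alpha0 alpha_lt.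
set f := Phi alpha phi; set g := pinv _ _; set q := `|alpha| * k in k1.
have aab : a <= a <= b by rewrite lexx ltW.
have bab : a <= b <= b by rewrite lexx ltW.
have fE t : f t = t + alpha * phi t by [].
have fa : f a = a by rewrite fE phia mulr0 addr0.
have fb : f b = b by rewrite fE phib mulr0 addr0.
have dphi x y : a <= x <= b -> a <= y <= b ->
    `|alpha * phi x - alpha * phi y| <= q * `|x - y|.
  move=> xab yab; rewrite -mulrBr normrM -mulrA; apply: ler_wpM2l => //.
  exact: phik.
have f_lt x y : a <= x <= b -> a <= y <= b -> x < y -> f x < f y.
  move=> xab yab xy; have := dphi y x yab xab.
  (* This yields [f y - f x >= (1 - q) * (y - x)]. *)
  rewrite ler_norml gtr0_norm ?subr_gt0 // => /andP[+ _].
  have : 0 < (1 - q) * (y - x) by rewrite mulr_gt0 // subr_gt0.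
  by rewrite !fE; lra.
have f_le x y : a <= x <= b -> a <= y <= b -> (f x <= f y) = (x <= y).
  move=> xab yab; case: (ltgtP x y) => [xy|yx|->]; last by rewrite lexx.
    by rewrite ltW // f_lt.
  by apply/negbTE; rewrite -ltNge f_lt.
have fI : stable a b f.
  by move=> t tab; rewrite -{1}fa -{1}fb !f_le.
have f_inj : {in `[a, b]%classic &, injective f}.
  move=> x y; rewrite !inE /= !in_itv /= => xab yab fxy.
  by apply/le_anti; rewrite -(f_le x y) // -(f_le y x) // fxy lexx.
have cf : contC a b f.
  apply/contCP => x xab e e0; have K0 : 0 < 1 + `|q| by rewrite ltr_wpDr.
  (* [1 + q] bounds the Lipschitz constant of [f]; the absolute value makes the divisor visibly
     positive. *)
  exists (e / (1 + `|q|)) => [|y yab]; first exact: divr_gt0.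
  rewrite ltr_pdivlMr // => xye; apply: le_lt_trans xye.
  rewrite !fE opprD addrACA (le_trans (ler_normD _ _)) // mulrDr mulr1 lerD2l.
  by rewrite (le_trans (dphi x y xab yab)) // mulrC ler_wpM2l // ler_norm.
have f_surj : set_surj `[a, b] `[a, b] f.
  move=> z /=; rewrite in_itv /= => /andP[az zb].
  have [|x xab fx] := @IVT R f a b z (ltW ab) cf; last by exists x.
  by rewrite fa fb ge_min le_max az zb orbT.
have gI : stable a b g.
  move=> t tab; have : (g @` `[a, b]) (g t) by exists t => //=; rewrite in_itv.
  by move=> /(surjpinv_image_sub f_surj); rewrite /= in_itv.
have gK t : a <= t <= b -> f (g t) = t.
  by move=> tab; rewrite (surjpK _ f_surj) // inE /= in_itv.
have fK t : a <= t <= b -> g (f t) = t.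
  by move=> tab; rewrite /g (pinvKV _ f_inj) // inE /= in_itv.
by split => // t tab; rewrite fE ltrDl phi_gt0 // in_itv.
Qed.

Theorem lemma2 (R : realType) (tm tp : R) (phi : R -> R) (alpha : R)
    (tm_lt_tp : tm < tp)
    (phi_tm : phi tm = 0) (phi_tp : phi tp = 0)
    (phi_neq0 : forall t : R, t \in `]tm, tp[ -> phi t != 0)
    (phi_nondeg : nondegenerate_on tm tp phi)
    (alpha_neq0 : 0 < `|alpha|)
    (alpha_small : `|alpha| < 1 / Lip_norm tm tp phi)
    (alpha_phi_gt0 : forall t : R, t \in `]tm, tp[ -> 0 < alpha * phi t) :
  Delta_range tm tp (Phi alpha phi) = admissible tm tp (Phi alpha phi) /\
  forall w : R -> R, admissible tm tp (Phi alpha phi) w ->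
    [/\ (forall v : R -> R, contC tm tp v ->
           solves tm tp (Phi alpha phi) v w
             <-> fwd_eq tm tp (Phi alpha phi) v w),
        (forall v : R -> R, contC tm tp v ->
           solves tm tp (Phi alpha phi) v w
             <-> bwd_eq tm tp (Phi alpha phi) v w),
        (forall c : R, exists v : R -> R,
           [/\ contC tm tp v, v tp = c & fwd_eq tm tp (Phi alpha phi) v w]),
        (forall c : R, exists v : R -> R,
           [/\ contC tm tp v, v tm = c & bwd_eq tm tp (Phi alpha phi) v w]) &
        (forall v v' : R -> R, contC tm tp v -> contC tm tp v' ->
           solves tm tp (Phi alpha phi) v w ->
           (solves tm tp (Phi alpha phi) v' w <->
            exists c : R, forall t : R, t \in `[tm, tp] -> v' t = v t + c))].
Proof.
have fg := displacement_Phi tm_lt_tp phi_tm phi_tp alpha_phi_gt0 alpha_neq0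
  alpha_small.
split=> [|w aw]; first exact: Delta_rangeE.
split=> [v cv|v cv|c|c|v v' cv cv' vw].
- exact: solves_fwdP.
- exact: solves_bwdP.
- exact: fwd_eq_ex.
- exact: bwd_eq_ex.
- exact: solves_unique.
Qed.
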